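(* Let $g\in C_B^1[0,\infty)$. Then for every $n\in\mathbb{N}$ and every $x\in[0,\infty)$, $$|\mathcal{RL}_{n}^{[\alpha]}(g;x)-g(x)|\leq |g'(x)|\left|\frac{1+2\phi+2x\psi}{2(\psi+\beta_n)}\right|+2\sqrt{\Phi_{n,2}^{\alpha}(x)}\;\omega\left(g',\sqrt{\Phi_{n,2}^{\alpha}(x)}\right).$$
   Context: Standing data: $(\beta_n)_{n\in\mathbb N}$ is a strictly increasing sequence of real numbers with $\beta_1=1$ and $\beta_n\to\infty$; $\phi,\psi$ are fixed reals with $0\le\phi\le\psi$; $\alpha=\alpha_n\ge 0$ is a sequence of nonnegative reals (the index $n$ is suppressed). For $i\ge1$ put $x^{(i,-\alpha)}=\prod_{j=1}^{i}(x+(j-1)\alpha)$, and $x^{(0,-\alpha)}=1$. For $x\ge0$ and bounded locally integrable $g$ on $[0,\infty)$ (or, more generally, locally integrable $g$ for which the series converges absolutely) define $$\mathcal{RL}_{n}^{[\alpha]}(g;x)=\beta_n\sum_{i=0}^{\infty}(1+\beta_n\alpha)^{-x/\alpha}\left(\alpha+\frac{1}{\beta_n}\right)^{-i}\frac{x^{(i,-\alpha)}}{i!}\int_{i/\beta_n}^{(i+1)/\beta_n}g\left(\frac{\beta_n t+\phi}{\beta_n+\psi}\right)dt,$$ where for $\alpha=0$ the factor $(1+\beta_n\alpha)^{-x/\alpha}$ is read as its limit $e^{-\beta_n x}$. Put $\Phi_{n,2}^{\alpha}(x)=\mathcal{RL}_{n}^{[\alpha]}((t-x)^2;x)$, the operator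 acting on the function of the variable $t$. $C_B[0,\infty)$ is the space of bounded continuous real functions on $[0,\infty)$, and $C_B^1[0,\infty)=\{g\in C_B[0,\infty): g'\in C_B[0,\infty)\}$. For $\delta>0$, $\omega(f,\delta)=\sup_{x,u,v\ge0,\ |u-v|\le\delta}|f(x+u)-f(x+v)|$. *)

(* Defs.v *)
From HB Require Import structures.
From mathcomp Require Import all_boot all_order all_algebra.
From mathcomp Require Import all_classical all_reals all_analysis.
Import Order.TTheory GRing.Theory Num.Theory.
Import numFieldNormedType.Exports.

Set Implicit Arguments.
Unset Strict Implicit.
Unset Printing Implicit Defensive.

Local Open Scope classical_set_scope.
Local Open Scope ring_scope.

(* A function on [0, +oo[ is represented by a total function R -> R, of which
   only the values at nonnegative arguments are ever used. *)

Section Spaces.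
Variable R : realType.
Implicit Types (g f : R -> R) (x d : R).

Definition CB g : Prop :=
  {within `[0, +oo[, continuous g} /\ [bounded g x | x in `[0, +oo[].

Definition diff_quot g x : R -> R := fun y => (g y - g x) / (y - x).

(* The limit is taken along y >= 0, y != x: the two-sided derivative when
   0 < x, the right derivative at x = 0. *)
Definition deriv_hl g x : R :=
  lim (diff_quot g x y @[y --> within `[0, +oo[ x^']).

Definition derivable_hl g : Prop :=
  forall x, 0 <= x -> cvg (diff_quot g x y @[y --> within `[0, +oo[ x^']).

Definition CB1 g : Prop := [/\ CB g, derivable_hl g & CB (deriv_hl g)].

Definition omega f d : R :=
  sup [set z | exists x u v : R, [/\ 0 <= x, 0 <= u, 0 <= v, `|u - v| <= d
                               & z = `|f (x + u) - f (x + v)|]].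

End Spaces.

Section Operator.
Variable R : realType.

(* x^(i, -a) *)
Definition rising (a x : R) (i : nat) : R := \prod_(j < i) (x + j%:R * a).

(* (1 + b a)^(- x / a), read as its limit exp (- b x) when a = 0 *)
Definition RLfactor (b a x : R) : R :=
  if a == 0 then expR (- (b * x)) else (1 + b * a) `^ (- (x / a)).

(* In the definitions below, b and a stand for beta_n and alpha_n. *)
Definition RLterm (b a phi psi : R) (g : R -> R) (x : R) (i : nat) : R :=
  RLfactor b a x * (a + b^-1) ^- i * (rising a x i / i`!%:R) *
  \int[lebesgue_measure]_(t in `[i%:R / b, i.+1%:R / b])
     g ((b * t + phi) / (b + psi)).

Definition RL (b a phi psi : R) (g : R -> R) (x : R) : R :=
  b * limn (series (RLterm b a phi psi g x)).

Definition Phi2 (b a phi psi x : R) : R :=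
  RL b a phi psi (fun t => (t - x) ^+ 2) x.

End Operator.

(* Main.v *)
(** For each cell [[i/b, (i+1)/b]] the weight of the operator is a negative
    binomial probability (Poisson when [a = 0]).  These weights satisfy
    [(i+1) w_(i+1) = (y + i q) w_i] with [q < 1], which makes the moments finite
    and gives mean [b x] once the total mass is known to be [1].  Hence the
    operator is positive, preserves constants, and maps [t - x] to
    [(1/2 + phi - x psi) / (b + psi)].  For [d > 0] the mean value theorem and
    [omega(g', k d) <= (1 + k) omega(g', d)] give
    [|g t - g x - g'(x) (t - x)| <= omega(g', d) (|t - x| + (t - x)^2 / d)], and
    [|t - x| <= d/2 + (t - x)^2 / (2 d)] replaces the Cauchy-Schwarz step, so
    only the second moment [Phi] is needed.  Take [d = sqrt Phi], or [d -> 0]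
    when [Phi = 0]. *)

Require Import Defs.
From HB Require Import structures.
From mathcomp Require Import all_boot all_order all_algebra.
From mathcomp Require Import all_classical all_reals all_analysis.
From mathcomp Require Import ring lra.
Import Order.TTheory GRing.Theory Num.Theory.
Import numFieldNormedType.Exports.

Set Implicit Arguments.
Unset Strict Implicit.
Unset Printing Implicit Defensive.

Local Open Scope classical_set_scope.
Local Open Scope ring_scope.

(** * Moments of weights obeying a first-order linear recursion *)

Section PanjerRecursion.
Variables (R : realType) (w : nat -> R) (y q T : R).
Hypotheses (y_ge0 : 0 <= y) (q_ge0 : 0 <= q) (q_lt1 : q < 1).
Hypothesis w_ge0 : forall i, 0 <= w i.
Hypothesis w_rec : forall i, i.+1%:R * w i.+1 = (y + i%:R * q) * w i.

Let m1 i : R := i%:R * w i.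
Let m2 i : R := i%:R ^+ 2 * w i.

Let m1_ge0 i : 0 <= m1 i.
Proof. by rewrite mulr_ge0. Qed.

Let m2_ge0 i : 0 <= m2 i.
Proof. by rewrite mulr_ge0// sqr_ge0. Qed.

(* Shifting the index in [\sum_i i * w i] turns the recursion for [w] into a
   linear equation between consecutive moments. *)
Let series_m1S n : series m1 n.+1 = y * series w n + q * series m1 n.
Proof.
rewrite /series /= big_nat_recl// {1}/m1 mul0r add0r !mulr_sumr -big_split/=.
apply: eq_bigr => i _; rewrite /m1 w_rec; ring.
Qed.

Let series_m2S n : series m2 n.+1
  = y * series w n + (y + q) * series m1 n + q * series m2 n.
Proof.
rewrite /series /= big_nat_recl// {1}/m2 expr0n/= mul0r add0r !mulr_sumr.
rewrite -!big_split/=; apply: eq_bigr => i _.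
rewrite /m2 expr2 -mulrA w_rec /m1 -natr1; ring.
Qed.

Let cvg_series_bounded (u : nat -> R) (C : R) : (forall i, 0 <= u i) ->
  (forall n, series u n <= C) -> cvgn (series u).
Proof.
move=> u0 uC; apply: nondecreasing_is_cvgn.
  by apply/nondecreasing_seqP => n; rewrite seriesSr lerDl.
by exists C => _ [n _ <-].
Qed.

(** Partial sums increase, so the shifted identity yields [m <= y * C + q * m], which can be solved
    for [m] because [q < 1]. *)
Lemma panjer_moment1_le C : (forall n, series w n <= C) ->
  forall n, series m1 n <= y * C / (1 - q).
Proof.
move=> wC n; rewrite ler_pdivlMr ?subr_gt0//.
have le1 : series m1 n <= series m1 n.+1 by rewrite seriesSr lerDl.
have le2 : y * series w n <= y * C by rewrite ler_wpM2l.
rewrite series_m1S in le1; lra.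
Qed.

Lemma panjer_is_cvg_moment1 C : (forall n, series w n <= C) ->
  cvgn (series m1).
Proof. by move=> /panjer_moment1_le; exact: cvg_series_bounded. Qed.

Lemma panjer_is_cvg_moment2 C : (forall n, series w n <= C) ->
  cvgn (series m2).
Proof.
move=> wC; pose D := y * C / (1 - q).
apply: (@cvg_series_bounded _ ((y * C + (y + q) * D) / (1 - q))) => // n.
rewrite ler_pdivlMr ?subr_gt0//.
have le1 : series m2 n <= series m2 n.+1 by rewrite seriesSr lerDl.
have le2 : y * series w n <= y * C by rewrite ler_wpM2l.
have le3 : (y + q) * series m1 n <= (y + q) * D.
  by rewrite ler_wpM2l ?addr_ge0// panjer_moment1_le.
rewrite series_m2S in le1; lra.
Qed.

(** In the limit the shifted identity becomes [M = y * T + q * M]; the finiteness of [M], obtained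
    first, permits solving it. *)
Lemma panjer_cvg_moment1 : series w @ \oo --> T ->
  series m1 @ \oo --> y * T / (1 - q).
Proof.
move=> wT.
have wle n : series w n <= T.
  rewrite -(cvg_lim _ wT)//; apply: nondecreasing_cvgn_le; last exact: cvgP wT.
  by apply/nondecreasing_seqP => k; rewrite seriesSr lerDl.
have /cvg_ex[/= M mM] := @panjer_is_cvg_moment1 T wle.
have mM' : (series m1 n.+1) @[n --> \oo] --> y * T + q * M.
  under eq_fun do rewrite series_m1S.
  by apply: cvgD; apply: cvgMl_tmp.
have mM2 := mM'; rewrite (cvg_shiftS (series m1)) in mM2.
have e : M = y * T + q * M by rewrite -{1}(cvg_lim _ mM)// (cvg_lim _ mM2).
suff -> : y * T / (1 - q) = M by [].
apply/(canLR (mulfK _)); first by rewrite subr_eq0 gt_eqF.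
lra.
Qed.

End PanjerRecursion.

(** * Rising factorials *)

Lemma rising_ge0 (R : realType) (b x : R) i :
  0 <= b -> 0 <= x -> 0 <= rising b x i.
Proof.
by move=> b0 x0; apply: prodr_ge0 => j _; rewrite addr_ge0// mulr_ge0.
Qed.

Lemma risingS (R : realType) (b x : R) i :
  rising b x i.+1 = rising b x i * (x + i%:R * b).
Proof. by rewrite /rising big_ord_recr. Qed.

Lemma rising0 (R : realType) (b x : R) : rising b x 0 = 1.
Proof. by rewrite /rising big_ord0. Qed.

Lemma factS_quot (R : realType) (u v : R) i :
  i.+1%:R * (u / (i.+1)`!%:R * v) = u * v / i`!%:R.
Proof.
have f0 : (i`!%:R : R) != 0 by rewrite pnatr_eq0 -lt0n fact_gt0.
have i0 : (i.+1%:R : R) != 0 by rewrite pnatr_eq0.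
by rewrite factS natrM; field; rewrite f0 addrC natr1 i0.
Qed.

(** * Sum of the negative binomial series *)

Section NegativeBinomial.
Variables (R : realType) (c p : R).
Hypotheses (c_ge0 : 0 <= c) (p_ge0 : 0 <= p) (p_lt1 : p < 1).

(** These are the Taylor coefficients of [(1 - t) ^ (- c)] at 0. *)
Let a i : R := rising 1 c i / i`!%:R.

Let aS i : i.+1%:R * a i.+1 = (c + i%:R) * a i.
Proof.
have := factS_quot (rising 1 c i.+1) 1 i.
rewrite /a mulr1 => ->; rewrite risingS; ring.
Qed.

Let a_ge0 i : 0 <= a i.
Proof. by rewrite divr_ge0// rising_ge0. Qed.

Let w i := a i * p ^+ i.

Let w_ge0 i : 0 <= w i. Proof. by rewrite mulr_ge0// exprn_ge0. Qed.

Let w_rec i : i.+1%:R * w i.+1 = (c * p + i%:R * p) * w i.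
Proof. by rewrite /w mulrA aS exprS; ring. Qed.

Let S n : {poly R} := \poly_(i < n) a i.

(* [S n] satisfies the differential equation of [(1 - t) ^ (- c)] up to its
   leading term. *)
Let S_deriv n (t : R) :
  (1 - t) * (S n.+1)^`().[t] - c * (S n.+1).[t] = - (n.+1%:R * a n.+1 * t ^+ n).
Proof.
have -> : (S n.+1)^`().[t] = \sum_(i < n) (c + i%:R) * a i * t ^+ i.
  rewrite /S poly_def raddf_sum horner_sum big_ord_recl/=.
  rewrite expr0 alg_polyC derivC horner0 add0r; apply: eq_bigr => i _.
  rewrite derivZ hornerZ derivXn hornerMn hornerXn -aS /bump/= -mulr_natl.
  ring.
have -> : (S n.+1).[t] = \sum_(i < n) a i * t ^+ i + a n * t ^+ n.
  by rewrite horner_poly big_ord_recr.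
have e : t * (\sum_(i < n) (c + i%:R) * a i * t ^+ i)
    = \sum_(i < n) (i%:R) * a i * t ^+ i + n%:R * a n * t ^+ n.
  transitivity (\sum_(i < n.+1) i%:R * a i * t ^+ i).
    2: by rewrite big_ord_recr.
  rewrite big_ord_recl/= !mul0r add0r mulr_sumr; apply: eq_bigr => i _.
  by rewrite -aS /bump/= exprS; ring.
rewrite mulrBl mul1r e aS mulrDr.
have -> : \sum_(i < n) (c + i%:R) * a i * t ^+ i
  = c * (\sum_(i < n) a i * t ^+ i) + \sum_(i < n) (i%:R) * a i * t ^+ i.
  by rewrite mulr_sumr -big_split/=; apply: eq_bigr => i _; ring.
ring.
Qed.

(** Ratio of the truncated series to its expected sum. The differential equation of [S n] collapses
    its derivative to a single term, of constant sign on [[0, 1[]. *)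
Let h n t := (1 - t) `^ c * (S n).[t].

Let is_derive_h n (t : R) : t < 1 ->
  is_derive t (1 : R) (h n.+1)
    (- ((1 - t) `^ (c - 1) * (n.+1%:R * a n.+1 * t ^+ n))).
Proof.
move=> t1; have t1' : 0 < 1 - t by rewrite subr_gt0.
have d1 : is_derive t 1 (fun t : R => 1 - t) (- 1).
  apply: is_derive_eq (is_deriveB (is_derive_cst (1 : R) t (1 : R))
    (is_derive_id t (1 : R))) _.
  by rewrite sub0r.
have d2 : is_derive t (1 : R) (fun t : R => (1 - t) `^ c)
    (c * (1 - t) `^ (c - 1) * (- 1)).
  exact: (@is_derive1_comp R (fun u : R => u `^ c) (fun t : R => 1 - t) t _ _
    (@is_derive1_powR R c (1 - t) t1') d1).
have d3 := is_deriveM d2 (is_derive_poly (S n.+1) t).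
apply: is_derive_eq d3 _.
rewrite /= -mulrN -S_deriv /GRing.scale/=.
have -> : (1 - t) `^ c = (1 - t) `^ (c - 1) * (1 - t).
  by rewrite -[X in _ * X](powRr1 (ltW t1')) -powRD
    ?subrK ?(gt_eqF t1') ?implybT.
ring.
Qed.

Let h0 n : h n.+1 0 = 1.
Proof.
rewrite /h subr0 powR1 mul1r horner_coef0 coef_poly/=.
by rewrite /a rising0 divr1.
Qed.

(** The mean value theorem from [h n.+1 0 = 1] gives the defect of [h] as one explicit term. Its
    sign bounds the partial sums; its size then gives their limit. *)
Let h_mvt n : 0 < p -> exists2 t : R, 0 < t < p &
  1 - h n.+1 p = (1 - t) `^ (c - 1) * (n.+1%:R * a n.+1 * t ^+ n) * p.
Proof.
move=> p0; have [|t||t] := @MVT _ (h n.+1)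
    (fun t => - ((1 - t) `^ (c - 1) * (n.+1%:R * a n.+1 * t ^+ n))) 0 p => //.
- by rewrite in_itv/= => /andP[_ tp]; apply: is_derive_h; exact: lt_trans p_lt1.
- apply: derivable_within_continuous => t; rewrite in_itv/= => /andP[_ tp].
  by have [] := is_derive_h n (le_lt_trans tp p_lt1).
- rewrite in_itv/= => tp; rewrite h0 subr0 => e; exists t => //.
  by rewrite -opprB e mulNr opprK.
Qed.

Let seriesE n : series w n = (S n).[p].
Proof. by rewrite horner_poly /series/= big_mkord. Qed.

Let h_le1 n : h n.+1 p <= 1.
Proof.
have [p0|] := ltP 0 p; last first.
  move=> p0; have -> : p = 0 by apply/le_anti/andP.
  by rewrite h0.
rewrite -subr_ge0; have [t /andP[t0 tp] ->] := h_mvt n p0.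
apply: mulr_ge0 (ltW p0); apply: mulr_ge0; first exact: powR_ge0.
by apply: mulr_ge0; [exact: mulr_ge0|apply: exprn_ge0; exact: ltW].
Qed.

Let hE n : h n p = (1 - p) `^ c * series w n.
Proof. by rewrite seriesE. Qed.

Let p1_gt0 : 0 < (1 - p) `^ c.
Proof. by rewrite powR_gt0// subr_gt0. Qed.

Let series_w_le n : series w n <= ((1 - p) `^ c)^-1.
Proof.
(* The bound on [h] holds at successor indices only, hence the extra term. *)
apply: (@le_trans _ _ (series w n.+1)); first by rewrite seriesSr lerDl.
by rewrite -[leRHS]mul1r ler_pdivlMr// mulrC -hE.
Qed.

(** Squeeze: the defect is at most a constant times [n.+1%:R * w n.+1], the general term of the
    convergent first-moment series. *)
Let h_cvg1 : (fun n => h n p) @ \oo --> (1 : R).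
Proof.
have [p0|] := ltP 0 p; last first.
  move=> p0; have -> : p = 0 by apply/le_anti/andP.
  rewrite -(cvg_shiftS (fun n => h n 0)); under eq_fun do rewrite h0.
  exact: cvg_cst.
have w0 := cvg_series_cvg_0 (@panjer_is_cvg_moment1 _ w (c * p) p
  (mulr_ge0 c_ge0 p_ge0) p_lt1 w_ge0 w_rec _ series_w_le).
have {}w0 : (n.+1%:R * w n.+1) @[n --> \oo] --> (0 : R).
  by rewrite (cvg_shiftS (fun n => n%:R * w n)).
rewrite -(cvg_shiftS (fun n => h n p)).
have lb : (1 - (1 - p)^-1 * (n.+1%:R * w n.+1)) @[n --> \oo] --> (1 : R).
  have e1 : 1 - (1 - p)^-1 * 0 = 1 :> R by rewrite mulr0 subr0.
  by rewrite -[X in _ --> X]e1; apply: cvgB; [exact: cvg_cst|exact: cvgMl_tmp].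
apply: squeeze_cvgr lb (cvg_cst (1 : R)); apply: nearW => n.
rewrite h_le1 andbT.
have [t /andP[t0 tp] e] := h_mvt n p0.
suff : 1 - h n.+1 p <= (1 - p)^-1 * (n.+1%:R * w n.+1).
  by move=> le1 /=; lra.
have t1 : 0 < 1 - t by rewrite subr_gt0 (lt_trans tp).
have p1 : 0 < 1 - p by rewrite subr_gt0.
(* The exponent [c - 1] may have either sign, so [(1 - t) ^ c <= 1] and [(1 - t)^-1 <= (1 - p)^-1]
   are used separately. *)
have pw : (1 - t) `^ (c - 1) <= (1 - p)^-1.
  rewrite powRB; last by rewrite (gt_eqF t1) implybT.
  rewrite powRr1 ?(ltW t1)// -[leRHS]mul1r.
  apply: ler_pM; rewrite ?powR_ge0 ?invr_ge0 ?(ltW t1)//.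
    by rewrite -[leRHS](powRr0 (1 - t)); apply: ger_powR => //; lra.
  by rewrite lef_pV2 ?posrE//; lra.
have na : 0 <= n.+1%:R * a n.+1 by exact: mulr_ge0.
have kt : n.+1%:R * a n.+1 * t ^+ n <= n.+1%:R * a n.+1 * p ^+ n.
  by apply: ler_wpM2l => //; apply: lerXn2r; rewrite ?nnegrE ltW.
have -> : (1 - p)^-1 * (n.+1%:R * w n.+1)
    = (1 - p)^-1 * (n.+1%:R * a n.+1 * p ^+ n) * p by rewrite /w exprSr; ring.
rewrite e ler_pM2r//; apply: ler_pM => //; first exact: powR_ge0.
by apply: mulr_ge0 => //; apply: exprn_ge0; exact: ltW.
Qed.

Lemma cvg_negative_binomial :
  series (fun i => rising 1 c i / i`!%:R * p ^+ i) @ \oo --> (1 - p) `^ (- c).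
Proof.
have := cvgMl_tmp (a := ((1 - p) `^ c)^-1) h_cvg1; rewrite mulr1 powRN.
under eq_fun do rewrite hE mulKf ?gt_eqF//.
by apply.
Qed.

End NegativeBinomial.

(** * Total mass and moments of the weights of the operator *)

Section Weights.
Variables (R : realType) (b a x : R).
Hypotheses (b_gt0 : 0 < b) (a_ge0 : 0 <= a) (x_ge0 : 0 <= x).

Definition RLweight (i : nat) : R :=
  RLfactor b a x * (a + b^-1) ^- i * (rising a x i / i`!%:R).

(** Parameters of the recursion for the weights. Since [1 - q = (1 + a * b)^-1], the mean
    [y / (1 - q)] is [b * x]; [a = 0] gives [q = 0], the Poisson case. *)
Let y := b * x / (1 + a * b).
Let q := a * b / (1 + a * b).

Let ab_gt0 : 0 < 1 + a * b.
Proof. by rewrite ltr_pwDl// mulr_ge0// ltW. Qed.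

Let y_ge0 : 0 <= y.
Proof. by apply: divr_ge0; [apply: mulr_ge0 => //|]; exact: ltW. Qed.

Let q_lt1 : q < 1.
Proof. by rewrite ltr_pdivrMr// mul1r ltrDr. Qed.

Let q_ge0 : 0 <= q.
Proof. by apply: divr_ge0; [apply: mulr_ge0 => //|]; exact: ltW. Qed.

Lemma RLfactor_ge0 : 0 <= RLfactor b a x.
Proof.
by rewrite /RLfactor; case: ifP => _; [exact: expR_ge0|exact: powR_ge0].
Qed.

Lemma RLweight_ge0 i : 0 <= RLweight i.
Proof.
apply: mulr_ge0; last by rewrite divr_ge0// rising_ge0.
rewrite mulr_ge0 ?RLfactor_ge0// invr_ge0 exprn_ge0// addr_ge0//.
by rewrite invr_ge0 ltW.
Qed.

Let RLweight_rec i : i.+1%:R * RLweight i.+1 = (y + i%:R * q) * RLweight i.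
Proof.
have b0 : b != 0 by rewrite gt_eqF.
have ab0 : 1 + a * b != 0 by rewrite gt_eqF.
have e := factS_quot (rising a x i.+1) 1 i; rewrite mulr1 in e.
have -> : i.+1%:R * RLweight i.+1 = RLfactor b a x * (a + b^-1) ^- i.+1 *
   (i.+1%:R * (rising a x i.+1 / (i.+1)`!%:R)) by rewrite /RLweight; ring.
rewrite e risingS exprS invfM mulr1 /RLweight.
have -> : (a + b^-1)^-1 = b / (1 + a * b). by field; rewrite ab0 b0.
rewrite /y /q; move: ((a + b^-1) ^- i) (i`!%:R : R)^-1 => z f.
by field; rewrite ?ab0.
Qed.

(** For [a = 0] this is the exponential series. Otherwise, taking [a ^+ i] out of the rising
    factorial leaves the negative binomial series with [c = x / a] and [p = q]. *)
Lemma cvg_series_RLweight : series RLweight @ \oo --> (1 : R).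
Proof.
have [a0|a0] := eqVneq a 0.
  have -> : RLweight = expR (- (b * x)) *: exp_coeff (b * x).
    apply/funext => i; rewrite /RLweight /RLfactor a0 eqxx add0r.
    rewrite /rising (eq_bigr (fun=> x)) ?prodr_const ?card_ord; last first.
      by move=> j _; rewrite mulr0 addr0.
    have -> : (expR (- (b * x)) *: exp_coeff (b * x)) i
      = expR (- (b * x)) * ((b * x) ^+ i / i`!%:R) by [].
    by rewrite -exprVn invrK exprMn; ring.
  have -> : series (expR (- (b * x)) *: exp_coeff (b * x)) =
      fun n => expR (- (b * x)) * series (exp_coeff (b * x)) n.
    by apply/funext => n; rewrite /series/= mulr_sumr.
  rewrite -(expRxMexpNx_1 (b * x)) [expR (b * x) * _]mulrC; apply: cvgMl_tmp.
  exact: is_cvg_series_exp_coeff.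
have a_gt0 : 0 < a by rewrite lt_neqAle eq_sym a0.
have b0 : b != 0 by rewrite gt_eqF.
have ab0 : 1 + a * b != 0 by rewrite gt_eqF.
have c_ge0 : 0 <= x / a by rewrite divr_ge0.
have := cvgMl_tmp (a := (1 + b * a) `^ (- (x / a)))
  (cvg_negative_binomial c_ge0 q_ge0 q_lt1).
(* The prefactor cancels the sum because [(1 + b * a) * (1 - q) = 1]. *)
have -> : (1 + b * a) `^ (- (x / a)) * (1 - q) `^ (- (x / a)) = 1.
  rewrite -powRM ?subr_ge0 ?(ltW q_lt1) 1?mulrC ?(ltW ab_gt0)//.
  by rewrite (_ : _ * _ = 1) ?powR1// /q; field; rewrite ab0.
have -> : series RLweight = fun n => (1 + b * a) `^ (- (x / a)) *
    series (fun i => rising 1 (x / a) i / i`!%:R * q ^+ i) n.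
  apply/funext => n; rewrite /series/= mulr_sumr; apply: eq_bigr => i _.
  rewrite /RLweight /RLfactor (negbTE a0).
  have -> : rising a x i = a ^+ i * rising 1 (x / a) i.
    elim: i => [|i IH]; first by rewrite !rising0 mulr1.
    by rewrite !risingS IH exprS; field.
  have -> : q ^+ i = (a + b^-1) ^- i * a ^+ i.
    rewrite -exprVn -exprMn; congr (_ ^+ _); rewrite /q; field.
    by rewrite b0 [_ + 1]addrC.
  by move: ((a + b^-1) ^- i) (a ^+ i) => z u; ring.
by apply.
Qed.

Lemma series_RLweight_le1 n : series RLweight n <= 1.
Proof.
rewrite -(cvg_lim _ cvg_series_RLweight)//.
apply: nondecreasing_cvgn_le; last exact: cvgP cvg_series_RLweight.
by apply/nondecreasing_seqP => k; rewrite seriesSr lerDl RLweight_ge0.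
Qed.

Lemma cvg_RLweight_moment1 :
  series (fun i => i%:R * RLweight i) @ \oo --> b * x.
Proof.
have ab0 : 1 + a * b != 0 by rewrite gt_eqF.
have q1 : 1 - q = (1 + a * b)^-1 by rewrite /q; field.
have -> : b * x = y * 1 / (1 - q) by rewrite q1 invrK mulr1 divfK.
apply: panjer_cvg_moment1 => //; first exact: RLweight_ge0.
exact: cvg_series_RLweight.
Qed.

Lemma is_cvg_RLweight_moment2 :
  cvgn (series (fun i => i%:R ^+ 2 * RLweight i)).
Proof.
apply: (@panjer_is_cvg_moment2 _ _ y q _ _ _ _ _ 1) => //.
  exact: RLweight_ge0.
exact: series_RLweight_le1.
Qed.

End Weights.

(** * Modulus of continuity of a bounded function *)

Section Modulus.
Variable R : realType.
Implicit Types f g : R -> R.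

Lemma CB_bounded f : CB f -> exists2 M, 0 < M & forall t, 0 <= t -> `|f t| <= M.
Proof.
move=> [_ /ex_strict_bound_gt0[M M0 fM]]; exists M => // t t0.
by apply/ltW/fM; rewrite /= in_itv/= t0.
Qed.

Variables (f : R -> R) (M : R).
Hypothesis fM : forall t, 0 <= t -> `|f t| <= M.

(** Boundedness of [f] is what makes the [sup] in [omega] a genuine upper bound; the base point is
    taken to be 0. *)
Lemma le_omega d s t : 0 <= s -> 0 <= t -> `|s - t| <= d ->
  `|f s - f t| <= omega f d.
Proof.
move=> s0 t0 std; apply: ub_le_sup; last first.
  by exists 0, s, t; rewrite !add0r.
exists (M + M) => _ [x [u [v [x0 u0 v0 _ ->]]]].
by rewrite (le_trans (ler_normB _ _))// lerD// fM// addr_ge0.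
Qed.

Lemma omega_ge0 d : 0 <= d -> 0 <= omega f d.
Proof.
move=> d0; apply: le_trans (normr_ge0 (f 0 - f 0)) _.
by apply: le_omega; rewrite // subrr normr0.
Qed.

(** Used when the second moment vanishes: there [omega] is multiplied by a factor tending to 0, so a
    crude bound suffices. *)
Lemma omega_le_bound d : 0 <= d -> omega f d <= M + M.
Proof.
move=> d0; apply: ge_sup.
  by exists `|f (0 + 0) - f (0 + 0)|; exists 0, 0, 0; rewrite subrr normr0.
move=> _ [x [u [v [x0 u0 v0 _ ->]]]].
by rewrite (le_trans (ler_normB _ _))// lerD// fM// addr_ge0.
Qed.

Lemma omega_chain d (n : nat) s t : 0 <= s -> 0 <= t ->
  `|s - t| <= n%:R * d -> `|f s - f t| <= n%:R * omega f d.
Proof.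
move=> s0; elim: n t => [|n IH] t t0.
  by rewrite mul0r normr_le0 subr_eq0 => /eqP ->; rewrite subrr normr0 mul0r.
move=> st; have n1 : 0 < n.+1%:R :> R by rewrite ltr0n.
(* With [z] at the fraction [n / n.+1] of the way from [s] to [t], the last step has length at most
   [d] and the rest falls under the induction hypothesis. *)
pose z := s + (t - s) * (n%:R / n.+1%:R).
have sz : s - z = (s - t) * (n%:R / n.+1%:R) by rewrite /z; ring.
have zt : z - t = (s - t) / n.+1%:R.
  by rewrite /z -natr1; field; rewrite natr1 gt_eqF.
have z0 : 0 <= z.
  have -> : z = s / n.+1%:R + t * (n%:R / n.+1%:R).
    by rewrite /z -natr1; field; rewrite natr1 gt_eqF.
  by rewrite addr_ge0// mulr_ge0// divr_ge0.
rewrite (le_trans (ler_distD (f z) _ _))// -natr1 mulrDl mul1r lerD//.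
  apply: IH => //; rewrite sz normrM (ger0_norm (x := _ / _)) ?divr_ge0//.
  rewrite mulrA ler_pdivrMr//; have := ler_wpM2r (ler0n R n) st.
  by rewrite (_ : n.+1%:R * d * n%:R = n%:R * d * n.+1%:R)//; ring.
apply: le_omega => //; rewrite zt normrM normfV (ger0_norm (ler0n R n.+1)).
by rewrite ler_pdivrMr// mulrC.
Qed.

Lemma le_omega_dilate d s t : 0 < d -> 0 <= s -> 0 <= t ->
  `|f s - f t| <= (1 + `|s - t| / d) * omega f d.
Proof.
move=> d0 s0 t0; have std : 0 <= `|s - t| / d by rewrite divr_ge0// ltW.
have [le1 lt2] := andP (truncn_itv std).
(* [n.+1] steps of length [d] cover the distance, and [n.+1] is at most [1 + |s - t| / d]. *)
set n := Num.truncn _ in le1 lt2.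
apply: (@le_trans _ _ (n.+1%:R * omega f d)).
  by apply: omega_chain => //; rewrite -ler_pdivrMr// ltW.
by apply: ler_wpM2r; [exact/omega_ge0/ltW|rewrite -natr1; lra].
Qed.

End Modulus.

(** * First-order Taylor remainder on the half-line *)

Section Taylor.
Variables (R : realType) (g : R -> R).
Hypothesis g_CB1 : CB1 g.

Lemma is_derive_deriv_hl (x : R) : 0 < x ->
  is_derive x (1 : R) g (deriv_hl g x).
Proof.
move=> x0; have [_ /(_ _ (ltW x0)) dg _] := g_CB1.
have dgx : (fun h : R => h^-1 *: (g (h *: 1 + x) - g x)) @ 0^' --> deriv_hl g x.
  have sh : (h + x) @[h --> (0 : R)^'] --> within `[0, +oo[ x^'.
    move=> P; rewrite /within/= => -[e e0 eP].
    (* Increments smaller than [x] keep [h + x] in the half-line, so the restricted limit is the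
       two-sided derivative. *)
    exists (Num.min e x) => /=; first by rewrite lt_min e0.
    move=> h /=; rewrite sub0r normrN lt_min => /andP[he hx] h0.
    apply: eP => /=.
    - by rewrite opprD addrCA subrr addr0 normrN.
    - by rewrite -subr_eq0 addrK.
    - by rewrite in_itv/= andbT; move: hx; rewrite ltr_norml; lra.
  have := cvg_comp _ _ sh dg; apply: cvg_trans.
  apply: near_eq_cvg; apply: nearW => h /=.
  by rewrite /diff_quot addrK /GRing.scale/= mulr1 mulrC.
by split; [exact: cvgP dgx|exact: cvg_lim dgx].
Qed.

(** The endpoint [x = 0] is covered, since differentiability is required only inside the interval
    and continuity on its closure. *)
Lemma deriv_hl_mvt (x t : R) : 0 <= x -> x < t ->
  exists2 z : R, x < z < t & g t - g x = deriv_hl g z * (t - x).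
Proof.
move=> x0 xt; have [[gc _] _ _] := g_CB1.
have [z||z] := @MVT _ g (deriv_hl g) x t xt.
- rewrite in_itv/= => /andP[xz _]; apply: is_derive_deriv_hl.
  exact: le_lt_trans xz.
- apply: continuous_subspaceW gc => z /=.
  by rewrite !in_itv/= andbT => /andP[xz _]; exact: le_trans xz.
- by rewrite in_itv/= => zxt e; exists z.
Qed.

(** The remainder is [(g'(z) - g'(x)) * (t - x)] with [z] between [x] and [t]. The coefficients come
    from [r + r ^ 2 / d] with [r <= d / 2 + r ^ 2 / (2 * d)]. *)
Lemma deriv_hl_remainder (d x t : R) : 0 < d -> 0 <= x -> 0 <= t ->
  `|g t - g x - deriv_hl g x * (t - x)|
    <= omega (deriv_hl g) d * (d / 2 + 3 / (2 * d) * (t - x) ^+ 2).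
Proof.
move=> d0 x0 t0; have [_ _ /CB_bounded[M M0 dgM]] := g_CB1.
have w0 := omega_ge0 dgM (ltW d0).
have [z [z0 zx e]] : exists z, [/\ 0 <= z, `|z - x| <= `|t - x| &
    g t - g x = deriv_hl g z * (t - x)].
  have [tx|xt|->] := ltgtP t x.
  - have [z /andP[tz zx] e] := deriv_hl_mvt t0 tx; exists z; split.
    + by rewrite (le_trans t0)// ltW.
    + by rewrite !ltr0_norm; lra.
    + by rewrite -opprB e; ring.
  - have [z /andP[xz zt] e] := deriv_hl_mvt x0 xt; exists z; split=> //.
    + by rewrite (le_trans x0)// ltW.
    + by rewrite !gtr0_norm; lra.
  - by exists x; rewrite !subrr mulr0.
rewrite e -mulrBl normrM.
have h1 : `|deriv_hl g z - deriv_hl g x|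
    <= (1 + `|t - x| / d) * omega (deriv_hl g) d.
  apply: le_trans (le_omega_dilate dgM d0 z0 x0) _.
  by apply: ler_wpM2r => //; rewrite lerD2l ler_pM2r ?invr_gt0.
apply: le_trans (ler_wpM2r (normr_ge0 _) h1) _.
rewrite mulrAC mulrC; apply: ler_wpM2l => //.
rewrite -real_normK ?num_real//; set r := `|t - x|.
(* AM-GM: [r <= d / 2 + r ^ 2 / (2 d)] *)
have -> : d / 2 + 3 / (2 * d) * r ^+ 2
    = (1 + r / d) * r + (r - d) ^+ 2 / (2 * d) by field; rewrite gt_eqF.
by rewrite lerDl divr_ge0 ?sqr_ge0// mulr_ge0// ltW.
Qed.

End Taylor.

(** * Integrals over one cell *)

Section CellIntegral.
Variables (R : realType) (b phi psi : R) (i : nat).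
Hypotheses (b_gt0 : 0 < b) (phi_ge0 : 0 <= phi) (psi_ge0 : 0 <= psi).

Let I : set R := `[i%:R / b, i.+1%:R / b].
Let s (t : R) := (b * t + phi) / (b + psi).

(** Isolated as a functional of [h], so that [RLterm] is by conversion a weight times this
    integral. *)
Definition RLint (h : R -> R) : R :=
  \int[lebesgue_measure]_(t in `[i%:R / b, i.+1%:R / b])
     h ((b * t + phi) / (b + psi)).

Let cont0 (h : R -> R) := {within `[0, +oo[, continuous h}.

Let bpsi_gt0 : 0 < b + psi.
Proof. exact: ltr_wpDr. Qed.

Lemma RLnode_itv t : I t -> 0 <= s t <= (i%:R + 1 + phi) / (b + psi).
Proof.
rewrite /I/= in_itv/= ler_pdivrMr// ler_pdivlMr// -natr1 => /andP[it ti].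
have i0 : 0 <= i%:R :> R by [].
have phi0 := phi_ge0.
apply/andP; split; first by rewrite divr_ge0 ?(ltW bpsi_gt0)//; lra.
by rewrite ler_pM2r ?invr_gt0//; lra.
Qed.

(** Continuity of [h] is known only within the half-line, so the composition has to use that [s]
    maps the cell into it. *)
Let integrable_cell (h : R -> R) : cont0 h ->
  lebesgue_measure.-integrable I (EFin \o (h \o s)).
Proof.
move=> ch; apply: continuous_compact_integrable; first exact: segment_compact.
apply/subspace_continuousP => t It.
have s0 u : I u -> 0 <= s u by move=> /RLnode_itv /andP[].
have st : s u @[u --> within I (nbhs t)] --> within `[0, +oo[ (nbhs (s t)).
  have cs : {for t, continuous s}.
    apply: cvgMr_tmp; apply: cvgD; last exact: cvg_cst.
    by apply: cvgMl_tmp; exact: cvg_id.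
  move=> P /cs; rewrite /within/= nbhs_simpl/=; apply: filterS => u Pu Iu.
  by apply: Pu; rewrite /= in_itv/= s0.
apply: cvg_comp st _; move/subspace_continuousP : ch; apply.
by rewrite /= in_itv/= s0.
Qed.

Let mI : measurable I. Proof. exact: measurable_itv. Qed.

Lemma RLintD h1 h2 : cont0 h1 -> cont0 h2 ->
  RLint (fun y => h1 y + h2 y) = RLint h1 + RLint h2.
Proof. by move=> c1 c2; apply: RintegralD => //; exact: integrable_cell. Qed.

Lemma RLintB h1 h2 : cont0 h1 -> cont0 h2 ->
  RLint (fun y => h1 y - h2 y) = RLint h1 - RLint h2.
Proof. by move=> c1 c2; apply: RintegralB => //; exact: integrable_cell. Qed.

Lemma RLintZ k h : cont0 h -> RLint (fun y => k * h y) = k * RLint h.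
Proof. by move=> c; apply: RintegralZl => //; exact: integrable_cell. Qed.

Lemma RLint_ge0 h : (forall y, 0 <= y -> 0 <= h y) -> 0 <= RLint h.
Proof. by move=> h0; apply: Rintegral_ge0 => t /RLnode_itv /andP[/h0]. Qed.

Lemma le_RLint h1 h2 : cont0 h1 -> cont0 h2 ->
  (forall y, 0 <= y <= (i%:R + 1 + phi) / (b + psi) -> h1 y <= h2 y) ->
  RLint h1 <= RLint h2.
Proof.
move=> c1 c2 h12; apply: le_Rintegral => //; try exact: integrable_cell.
by move=> t /RLnode_itv; exact: h12.
Qed.

Lemma le_norm_RLint h1 h2 : cont0 h1 -> cont0 h2 ->
  (forall y, 0 <= y <= (i%:R + 1 + phi) / (b + psi) -> `|h1 y| <= h2 y) ->
  `|RLint h1| <= RLint h2.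
Proof.
move=> c1 c2 h12; apply: le_trans (le_normr_Rintegral _ _) _ => //.
  exact: integrable_cell.
apply: le_Rintegral => //; last by move=> t /RLnode_itv; exact: h12.
- exact: (integrable_norm (integrable_cell c1)).
- exact: integrable_cell.
Qed.

Lemma Rintegral_deriv (p : {poly R}) (u v : R) : u < v ->
  \int[lebesgue_measure]_(t in `[u, v]) p^`().[t] = p.[v] - p.[u].
Proof.
move=> uv; rewrite /Rintegral (@continuous_FTC2 _ _ (horner p) _ _ uv)//.
- by apply: continuous_subspaceT; exact: continuous_horner.
- split; first by move=> t _; exact: derivable_horner.
  + by apply: cvg_at_right_filter; exact: continuous_horner.
  + by apply: cvg_at_left_filter; exact: continuous_horner.
- by move=> t _; rewrite derivE.
Qed.

Let cell_lt : i%:R / b < i.+1%:R / b.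
Proof. by rewrite ltr_pM2r ?invr_gt0// ltr_nat. Qed.

Lemma RLint_cst k : RLint (fun=> k) = k / b.
Proof.
transitivity ((k *: 'X).[i.+1%:R / b] - (k *: 'X).[i%:R / b]).
  rewrite -Rintegral_deriv//; apply: eq_Rintegral => t _.
  by rewrite derivZ derivX !hornerE.
by rewrite !hornerE /= -natr1; field; rewrite gt_eqF.
Qed.

Lemma RLint_id : RLint id = (i%:R + 2^-1 + phi) / (b + psi) / b.
Proof.
(* An antiderivative of [(b * t + phi) / (b + psi)]. *)
pose p : {poly R} := (b / 2 / (b + psi)) *: 'X^2 + (phi / (b + psi)) *: 'X.
transitivity (p.[i.+1%:R / b] - p.[i%:R / b]).
  rewrite -Rintegral_deriv//; apply: eq_Rintegral => t _.
  rewrite derivD !derivZ derivX derivXn/= !hornerE /=.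
  by field; rewrite gt_eqF.
by rewrite !hornerE /= -natr1; field; rewrite !gt_eqF.
Qed.

End CellIntegral.

(** * Summing the cell estimates *)

Section Estimate.
Variables (R : realType) (b a phi psi x : R).
Hypotheses (b_gt0 : 0 < b) (a_ge0 : 0 <= a).
Hypotheses (phi_ge0 : 0 <= phi) (psi_ge0 : 0 <= psi) (x_ge0 : 0 <= x).

Let w := RLweight b a x.
Let J := RLint b phi psi.
Let cont0 (h : R -> R) := {within `[0, +oo[, continuous h}.

Let w_ge0 i : 0 <= w i. Proof. exact: RLweight_ge0. Qed.

Let b_neq0 : b != 0. Proof. by rewrite gt_eqF. Qed.

Let bpsi_gt0 : 0 < b + psi. Proof. exact: ltr_wpDr. Qed.

Let cont_cst (k : R) : cont0 (fun=> k).
Proof. by apply: continuous_subspaceT => y; exact: cvg_cst. Qed.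

Let cont_id : cont0 id.
Proof. by apply: continuous_subspaceT => y; exact: cvg_id. Qed.

Let cont_sub : cont0 (fun y => y - x).
Proof.
apply: continuous_subspaceT => y.
by apply: cvgB; [exact: cvg_id|exact: cvg_cst].
Qed.

Let cont_sqr : cont0 (fun y => (y - x) ^+ 2).
Proof.
apply: continuous_subspaceT => y; under eq_fun do rewrite expr2.
by apply: cvgM; (apply: cvgB; [exact: cvg_id|exact: cvg_cst]).
Qed.

Let contB (h1 h2 : R -> R) :
  cont0 h1 -> cont0 h2 -> cont0 (fun y => h1 y - h2 y).
Proof. by move=> c1 c2 y; apply: cvgB; [exact: c1|exact: c2]. Qed.

Let contD (h1 h2 : R -> R) :
  cont0 h1 -> cont0 h2 -> cont0 (fun y => h1 y + h2 y).
Proof. by move=> c1 c2 y; apply: cvgD; [exact: c1|exact: c2]. Qed.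

Let contZ k (h : R -> R) : cont0 h -> cont0 (fun y => k * h y).
Proof. by move=> c y; apply: cvgMl_tmp; exact: c. Qed.

Let J_sub i : J i (fun y => y - x) =
  ((i%:R + 2^-1 + phi) / (b + psi) - x) / b.
Proof.
rewrite /J (@RLintB _ _ _ _ i b_gt0 phi_ge0 psi_ge0 id (fun=> x))//.
  2: exact: cont_cst.
by rewrite RLint_id// RLint_cst// mulrBl.
Qed.

Let J_sqr_ge0 i : 0 <= J i (fun y => (y - x) ^+ 2).
Proof. by apply: RLint_ge0 => // y _; exact: sqr_ge0. Qed.

(** Quadratic growth in [i] is enough, the weights having a finite second moment. The constants come
    from [(y - x) ^ 2 <= y ^ 2 + x ^ 2] at nonnegative points and
    [(p + q) ^ 2 <= 2 * p ^ 2 + 2 * q ^ 2]. *)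
Let J_sqr_le : exists A B : R, forall i,
  J i (fun y => (y - x) ^+ 2) <= A * i%:R ^+ 2 + B.
Proof.
pose c := (b + psi)^-1; have c0 : 0 <= c by rewrite invr_ge0 ltW.
exists (2 * c ^+ 2 / b), ((2 * ((1 + phi) * c) ^+ 2 + x ^+ 2) / b) => i.
have -> : 2 * c ^+ 2 / b * i%:R ^+ 2 + (2 * ((1 + phi) * c) ^+ 2 + x ^+ 2) / b
  = J i (fun=> 2 * (i%:R * c) ^+ 2 + 2 * ((1 + phi) * c) ^+ 2 + x ^+ 2).
  by rewrite /J RLint_cst//; ring.
apply: le_RLint => // [|y /andP[y0 yi]]; first exact: cont_cst.
have yx : 0 <= y * x by rewrite mulr_ge0.
have y2 : y ^+ 2 <= ((i%:R + 1 + phi) * c) ^+ 2.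
  by rewrite lerXn2r// nnegrE// (le_trans y0).
rewrite -[_ + 1 + _]addrA mulrDl in y2.
have := sqr_ge0 (i%:R * c - (1 + phi) * c).
move: (i%:R * c) ((1 + phi) * c) y2 => p q y2 pq; lra.
Qed.

Let is_cvg_dominated (u : nat -> R) (A B : R) :
  (forall i, `|u i| <= A * i%:R ^+ 2 + B) ->
  cvgn (series (fun i => w i * u i)).
Proof.
move=> uAB; apply: normed_cvg.
have cAB : cvgn (series (fun i => w i * (A * i%:R ^+ 2 + B))).
  have -> : series (fun i => w i * (A * i%:R ^+ 2 + B)) =
      fun n => A * series (fun i => i%:R ^+ 2 * w i) n + B * series w n.
    apply/funext => n; rewrite /series/= !mulr_sumr -big_split/=.
    by apply: eq_bigr => i _; ring.
  apply: is_cvgD; apply: is_cvgMl_tmp.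
    exact: is_cvg_RLweight_moment2.
  exact: cvgP (cvg_series_RLweight b_gt0 a_ge0 x_ge0).
apply: series_le_cvg cAB => i /=.
- exact: normr_ge0.
- by rewrite mulr_ge0// (le_trans _ (uAB i)).
- by rewrite normrM (ger0_norm (w_ge0 i)) ler_wpM2l.
Qed.

Let is_cvg_sqr : cvgn (series (fun i => w i * J i (fun y => (y - x) ^+ 2))).
Proof.
have [A [B AB]] := J_sqr_le; apply: (is_cvg_dominated (A := A) (B := B)) => i.
by rewrite ger0_norm.
Qed.

(** Convergence is established first: only then does the sign of the partial sums pass to [limn]. *)
Lemma Phi2_ge0 : 0 <= Phi2 b a phi psi x.
Proof.
rewrite /Phi2 /RL mulr_ge0 ?(ltW b_gt0)//; apply: limr_ge.
  exact: is_cvg_sqr.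
apply: nearW => n; apply: sumr_ge0 => i _.
by apply: mulr_ge0; [exact: w_ge0|exact: J_sqr_ge0].
Qed.

Lemma cvg_RL_bounded (g : R -> R) M : cont0 g ->
  (forall y, 0 <= y -> `|g y| <= M) ->
  cvgn (series (RLterm b a phi psi g x)).
Proof.
move=> cg gM; apply: (is_cvg_dominated (A := 0) (B := M / b)) => i.
rewrite mul0r add0r -(RLint_cst phi psi i b_gt0 M).
apply: (@le_norm_RLint R b phi psi i b_gt0 phi_ge0 psi_ge0 g (fun=> M)) => //.
  exact: cont_cst.
by move=> y /andP[y0 _]; exact: gM.
Qed.

(** The cell integral of [y - x] is affine in [i], so the total mass and the mean of the weights
    determine the limit. *)
Let cvg_moment_sub : series (fun i => w i * J i (fun y => y - x)) @ \oo -->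
  (2^-1 + phi - x * psi) / (b + psi) / b.
Proof.
have -> : series (fun i => w i * J i (fun y => y - x)) =
  fun n => ((b + psi) * b)^-1 * series (fun i => i%:R * w i) n
    + ((2^-1 + phi) / (b + psi) - x) / b * series w n.
  apply/funext => n; rewrite /series/= !mulr_sumr -big_split/=.
  apply: eq_bigr => i _; rewrite J_sub; field.
  by rewrite b_neq0 gt_eqF.
have -> : (2^-1 + phi - x * psi) / (b + psi) / b = ((b + psi) * b)^-1 * (b * x)
    + ((2^-1 + phi) / (b + psi) - x) / b * 1.
  by field; rewrite b_neq0 gt_eqF.
apply: cvgD; apply: cvgMl_tmp.
  exact: cvg_RLweight_moment1.
exact: cvg_series_RLweight.
Qed.

Variable g : R -> R.
Hypothesis g_CB1 : CB1 g.

(** The pointwise Taylor bound integrated over a cell, whose length accounts for each division by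
    [b] of a constant. *)
Let J_remainder d i : 0 < d ->
  `|J i g - g x / b - deriv_hl g x * J i (fun y => y - x)|
    <= omega (deriv_hl g) d
       * (d / 2 / b + 3 / (2 * d) * J i (fun y => (y - x) ^+ 2)).
Proof.
move=> d0; have [[cg _] _ _] := g_CB1.
set k := deriv_hl g x; set o := omega _ d; set l := 3 / (2 * d).
have c1 : cont0 (fun y => g y - g x) by apply: contB => //; exact: cont_cst.
have c2 : cont0 (fun y => k * (y - x)) by exact: contZ.
have c3 : cont0 (fun y => l * (y - x) ^+ 2) by exact: contZ.
have c4 : cont0 (fun y => d / 2 + l * (y - x) ^+ 2).
  by apply: contD => //; exact: cont_cst.
have -> : J i g - g x / b - k * J i (fun y => y - x)
    = J i (fun y => g y - g x - k * (y - x)).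
  rewrite /J (@RLintB _ _ _ _ i b_gt0 phi_ge0 psi_ge0 _ _ c1 c2).
  rewrite (@RLintB _ _ _ _ i b_gt0 phi_ge0 psi_ge0 g _ cg (@cont_cst _)).
  by rewrite (@RLintZ _ _ _ _ i b_gt0 phi_ge0 psi_ge0 k _ cont_sub) RLint_cst.
have -> : o * (d / 2 / b + l * J i (fun y => (y - x) ^+ 2))
    = J i (fun y => o * (d / 2 + l * (y - x) ^+ 2)).
  rewrite /J (@RLintZ _ _ _ _ i b_gt0 phi_ge0 psi_ge0 o _ c4).
  rewrite (@RLintD _ _ _ _ i b_gt0 phi_ge0 psi_ge0 _ _ (@cont_cst _) c3).
  by rewrite (@RLintZ _ _ _ _ i b_gt0 phi_ge0 psi_ge0 l _ cont_sqr) RLint_cst.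
apply: (@le_norm_RLint _ _ _ _ i b_gt0 phi_ge0 psi_ge0) => //.
- exact: contB.
- exact: contZ.
- by move=> y /andP[y0 _]; exact: deriv_hl_remainder.
Qed.

Lemma RL_remainder d : 0 < d ->
  `|RL b a phi psi g x - g x
    - deriv_hl g x * ((2^-1 + phi - x * psi) / (b + psi))|
  <= omega (deriv_hl g) d * (d / 2 + 3 / (2 * d) * Phi2 b a phi psi x).
Proof.
move=> d0; have [gCB _ _] := g_CB1; have [M M0 gM] := CB_bounded gCB.
have [cg _] := gCB.
have cvg_g := cvg_RL_bounded cg gM.
have cvg_w := cvg_series_RLweight b_gt0 a_ge0 x_ge0.
(* [u] and [v] are the two sides at finite stage, with [series w n] standing for the total mass
   1. *)
pose u n := b * series (RLterm b a phi psi g x) n - g x * series w n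
  - deriv_hl g x * (b * series (fun i => w i * J i (fun y => y - x)) n).
pose v n := omega (deriv_hl g) d * (d / 2 * series w n +
  3 / (2 * d) * (b * series (fun i => w i * J i (fun y => (y - x) ^+ 2)) n)).
have ulim : u @ \oo --> RL b a phi psi g x - g x * 1
    - deriv_hl g x * (b * ((2^-1 + phi - x * psi) / (b + psi) / b)).
  apply: cvgB; first by apply: cvgB; exact: cvgMl_tmp.
  by apply: cvgMl_tmp; apply: cvgMl_tmp; exact: cvg_moment_sub.
have vlim : v @ \oo --> omega (deriv_hl g) d * (d / 2 * 1 +
    3 / (2 * d) * Phi2 b a phi psi x).
  apply: cvgMl_tmp; apply: cvgD; apply: cvgMl_tmp => //.
  apply: cvgMl_tmp; exact: is_cvg_sqr.
have -> : RL b a phi psi g x - g x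
    - deriv_hl g x * ((2^-1 + phi - x * psi) / (b + psi))
  = RL b a phi psi g x - g x * 1
    - deriv_hl g x * (b * ((2^-1 + phi - x * psi) / (b + psi) / b)).
  by rewrite mulr1 [b * _]mulrC divfK.
rewrite -[d / 2]mulr1; apply: ler_cvg_to (cvg_norm ulim) vlim _.
apply: nearW => n; rewrite /u /v.
have -> : b * series (RLterm b a phi psi g x) n - g x * series w n
  - deriv_hl g x * (b * series (fun i => w i * J i (fun y => y - x)) n)
  = \sum_(0 <= i < n) b * w i *
    (J i g - g x / b - deriv_hl g x * J i (fun y => y - x)).
  rewrite /series/= !mulr_sumr -!sumrB; apply: eq_bigr => i _.
  rewrite -[RLterm _ _ _ _ _ _ i]/(w i * J i g); field; exact: b_neq0.
have -> : omega (deriv_hl g) d * (d / 2 * series w n +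
  3 / (2 * d) * (b * series (fun i => w i * J i (fun y => (y - x) ^+ 2)) n))
  = \sum_(0 <= i < n) b * w i * (omega (deriv_hl g) d
       * (d / 2 / b + 3 / (2 * d) * J i (fun y => (y - x) ^+ 2))).
  rewrite /series/= !mulr_sumr -big_split/= mulr_sumr; apply: eq_bigr => i _.
  by field; rewrite b_neq0 gt_eqF.
apply: le_trans (ler_norm_sum _ _ _) _; apply: ler_sum => i _.
have bw : 0 <= b * w i by rewrite mulr_ge0// ltW.
by rewrite normrM (ger0_norm bw) ler_wpM2l// J_remainder.
Qed.

Lemma RL_remainder_sqrt :
  `|RL b a phi psi g x - g x
    - deriv_hl g x * ((2^-1 + phi - x * psi) / (b + psi))|
  <= 2 * Num.sqrt (Phi2 b a phi psi x)
     * omega (deriv_hl g) (Num.sqrt (Phi2 b a phi psi x)).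
Proof.
set E := `|_|; set P := Phi2 _ _ _ _ _.
have := Phi2_ge0; rewrite -/P le_eqVlt => /predU1P[P0|P_gt0].
  have [_ _ /CB_bounded[M M0 dgM]] := g_CB1.
  rewrite -P0 sqrtr0 mulr0 mul0r; apply/ler_addgt0Pl => e e0; rewrite addr0.
  (* Chosen so that the bound [(M + M) * (d / 2)] equals [e]. *)
  have d0 : 0 < e / M by rewrite divr_gt0.
  apply: le_trans (RL_remainder d0) _; rewrite -/P -P0 mulr0 addr0.
  apply: le_trans (ler_wpM2r _ (omega_le_bound dgM (ltW d0))) _.
    by rewrite divr_ge0// ltW.
  by rewrite [leLHS](_ : _ = e)//; field; rewrite gt_eqF.
have d0 : 0 < Num.sqrt P by rewrite sqrtr_gt0.
apply: le_trans (RL_remainder d0) _; rewrite -/P.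
(* With [Phi = d ^ 2] the factor [d / 2 + 3 / (2 * d) * Phi] is exactly [2 * d]. *)
rewrite -[in leLHS](sqr_sqrtr (ltW P_gt0)) mulrC sqrtr_sqr ger0_norm//.
by rewrite [X in X * _](_ : _ = 2 * Num.sqrt P)//; field; rewrite gt_eqF.
Qed.

End Estimate.

Unset Implicit Arguments.

Theorem theorem2p2 (R : realType) (beta alpha : nat -> R) (phi psi : R)
    (beta_incr : forall m n : nat, (1 <= m)%N -> (m < n)%N -> beta m < beta n)
    (beta1 : beta 1%N = 1)
    (beta_oo : beta n @[n --> \oo] --> +oo)
    (phi_ge0 : 0 <= phi) (phi_le_psi : phi <= psi)
    (alpha_ge0 : forall n : nat, (1 <= n)%N -> 0 <= alpha n)
    (g : R -> R) (g_CB1 : CB1 g) (n : nat) (n_ge1 : (1 <= n)%N)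
    (x : R) (x_ge0 : 0 <= x) :
  let Phi := Phi2 (beta n) (alpha n) phi psi x in
  `|RL (beta n) (alpha n) phi psi g x - g x| <=
    `|deriv_hl g x| * `|(1 + 2 * phi + 2 * x * psi) / (2 * (psi + beta n))|
    + 2 * Num.sqrt Phi * omega (deriv_hl g) (Num.sqrt Phi).
Proof.
have b_gt0 : 0 < beta n.
  case: n n_ge1 => [//|[|n]] _; first by rewrite beta1.
  by apply: lt_trans (beta_incr 1%N n.+2 _ _); rewrite // beta1.
have psi_ge0 : 0 <= psi by exact: le_trans phi_le_psi.
cbv zeta; set Phi := Phi2 _ _ _ _ _.
have := RL_remainder_sqrt b_gt0 (alpha_ge0 n n_ge1) phi_ge0 psi_ge0 x_ge0 g_CB1.
rewrite -/Phi.
set m := (_ / (beta n + psi)) => rem.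
have bp : 0 < psi + beta n by exact: ltr_wpDl.
have xpsi : 0 <= x * psi by rewrite mulr_ge0.
(* The exact first moment carries [- 2 * x * psi]; as all the summands are nonnegative, changing
   this sign can only enlarge the absolute value. *)
have m_le : `|m| <= `|(1 + 2 * phi + 2 * x * psi) / (2 * (psi + beta n))|.
  have -> : m = (1 + 2 * phi - 2 * x * psi) / (2 * (psi + beta n)).
    by rewrite /m [beta n + psi]addrC; field; rewrite gt_eqF.
  rewrite !normrM ler_wpM2r//.
  by rewrite [leRHS]ger0_norm ?ler_norml; [apply/andP; split|]; lra.
rewrite (_ : _ - g x = deriv_hl g x * m +
  (RL (beta n) (alpha n) phi psi g x - g x - deriv_hl g x * m)); last by ring.
apply: le_trans (ler_normD _ _) _; apply: lerD rem.
by rewrite normrM ler_wpM2l.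
Qed.
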